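(* The elements $t_1t_2\cdots t_k$, for $k\in\{0,1,\dots,n\}$ (with the empty product equal to $1$ for $k=0$), form a complete set of representatives of the $\mathcal{B}_n$-orbits in the set of planar words of $\Sigma_{0,1,n}$. That is, every planar word lies in the $\mathcal{B}_n$-orbit of $t_1\cdots t_k$ for exactly one $k$.
   Context: $\Sigma_{0,1,n}$ is the free group on $t_1,\dots,t_n$, with $\overline t_k=t_k^{-1}$ and $z_1=(t_1\cdots t_n)^{-1}$. Automorphisms act on the right. $\mathcal{B}_n$ is the group of automorphisms of $\Sigma_{0,1,n}$ fixing $z_1$ and permuting the conjugacy classes $\{[t_1],\dots,[t_n]\}$; it acts on $\Sigma_{0,1,n}$ and preserves the set of planar words. Let $A$ be the set of formal symbols $\overline z_1,t_1,\overline t_1,\dots,t_n,\overline t_n,z_1$, ordered by $\overline z_1<t_1<\overline t_1<\dots<t_n<\overline t_n<z_1$. For a reduced word $a_1\cdots a_m$, its Whitehead expansion is $(c_1,\dots,c_{2m+2})=(\overline z_1,a_1,\overline a_1,\dots,a_m,\overline a_m,z_1)$. Two $2$-element sets of integers $\{a,b\},\{c,d\}$ are nested if $a,b,c,d$ are distinct and either both or neither of $c,d$ lie strictly between $a$ and $b$. A $2M$-tuple $(c_1,\dots,c_{2M})$ of elements of $A$ is planar if some permutation $\pi$ of $\{1,\dots,2M\}$ satisfies three conditions: - $\pi(i)<\pi(j)\Rightarrow c_i\le c_j$; - the sets $\{\pi(2i-1),\pi(2i)\}$, $1\le i\le M$, are pairwise nested; - the sets $\{\pi(2i),\pi(2i+1)\}$,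 $1\le i\le M-1$, are pairwise nested. A word $w$ is planar if the Whitehead expansion of its reduced word is planar. *)

(* Defs.v *)
From mathcomp Require Import all_boot all_fingroup.
Set Implicit Arguments. Unset Strict Implicit. Unset Printing Implicit Defensive.

(** * The free group Sigma_{0,1,n} on t_1..t_n, as reduced words.
    A letter (i, false) is t_{i+1}; (i, true) is its inverse tbar_{i+1}. *)
Definition letter (n : nat) := ('I_n * bool)%type.
Definition word (n : nat) := seq (letter n).

Definition linv {n} (x : letter n) : letter n := (x.1, ~~ x.2).

Definition push {n} (x : letter n) (w : word n) : word n :=
  if w is y :: w' then (if y == linv x then w' else x :: w) else [:: x].
Definition reduce {n} (w : word n) : word n := foldr push [::] w.

Fixpoint reduced {n} (w : word n) : bool :=
  if w is x :: w' then
    (if w' is y :: _ then y != linv x else true) && reduced w'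
  else true.

Definition wmul {n} (u v : word n) : word n := reduce (u ++ v).
Definition winv {n} (w : word n) : word n := rev (map linv w).

Definition gen {n} (i : 'I_n) : word n := [:: (i, false)].

Definition tprod (n k : nat) : word n := [seq (i, false) | i <- take k (enum 'I_n)].

Definition z1 (n : nat) : word n := winv (tprod n n).

Definition subst {n} (f : 'I_n -> word n) (w : word n) : word n :=
  reduce (flatten [seq (if l.2 then winv (f l.1) else f l.1) | l <- w]).

Definition conjugate {n} (u v : word n) : Prop :=
  exists c : word n, reduce (winv c ++ u ++ c) = v.

Definition is_aut {n} (f : 'I_n -> word n) : Prop :=
  exists g : 'I_n -> word n,
    (forall i, subst g (f i) = gen i) /\ (forall i, subst f (g i) = gen i).

Definition in_Bn {n} (f : 'I_n -> word n) : Prop :=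
  [/\ is_aut f,
      subst f (z1 n) = z1 n &
      exists s : {perm 'I_n}, forall i, conjugate (subst f (gen i)) (gen (s i))].

Definition in_Bn_orbit {n} (w v : word n) : Prop :=
  exists f : 'I_n -> word n, in_Bn f /\ subst f w = v.

(** * Whitehead expansion and planarity.
    Symbols of A are coded by naturals respecting the order:
    zbar_1 = 0, t_{j+1} = 2j+1, tbar_{j+1} = 2j+2, z_1 = 2n+1. *)
Definition code {n} (x : letter n) : nat :=
  if x.2 then (val x.1).*2.+2 else (val x.1).*2.+1.

Definition wh_exp {n} (w : word n) : seq nat :=
  0 :: flatten [seq [:: code a; code (linv a)] | a <- w] ++ [:: n.*2.+1].

Definition between (x a b : nat) : bool := (minn a b < x) && (x < maxn a b).

Definition nested (a b c d : nat) : bool :=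
  uniq [:: a; b; c; d] && (between c a b == between d a b).

(** planar tuple (c_1..c_{2M}); positions are 0-indexed here, and the
    permutation pi of {0..2M-1} is given as the list of its values. *)
Definition planar_seq (c : seq nat) : Prop :=
  let N := size c in let M := N %/ 2 in
  exists s : seq nat,
    let pi := fun i => nth 0 s i in
    [/\ perm_eq s (iota 0 N),
        (forall i j, i < N -> j < N -> pi i < pi j -> nth 0 c i <= nth 0 c j),
        (forall i j, i < M -> j < M -> i != j ->
           nested (pi i.*2) (pi i.*2.+1) (pi j.*2) (pi j.*2.+1)) &
        (forall i j, i.+1 < M -> j.+1 < M -> i != j ->
           nested (pi i.*2.+1) (pi i.*2.+2) (pi j.*2.+1) (pi j.*2.+2))].

Definition planar {n} (w : word n) : Prop := planar_seq (wh_exp (reduce w)).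

(* Main.v *)
Require Import Defs.
From mathcomp Require Import all_boot all_fingroup all_algebra zify.
From Stdlib Require Import Setoid Morphisms.
Set Implicit Arguments. Unset Strict Implicit. Unset Printing Implicit Defensive.

(** Put n punctures on a horizontal line. A planar word describes a simple arc crossing the
    line: its points are the entries of the Whitehead expansion, the pairs
    {pi(2i-1), pi(2i)} are half-arcs above the line and the pairs {pi(2i), pi(2i+1)} are
    half-arcs below it. Labelling a point x by the number c x of punctures on its left,
    and writing P_k = t_1...t_k, the word is the product of the P_(c u)^-1 P_(c v) over
    the lower half-arcs (u, v). A braid may carry a puncture through a region of the lower
    half-plane from one segment of the line to another; this only changes the labels.
    Take an innermost upper half-arc (p, q) which does not contain an end point of the arc:
    after all punctures between p and q have been carried away, c p = c q, so P_(c p) and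
    P_(c q)^-1 cancel and the points p and q can be deleted. At the end at most one lower
    half-arc (x, y) remains, with x < y, and carrying the punctures left of x to the right
    of y turns the word into P_k. Finally k is the exponent sum, which braids preserve. *)

(** * The free group and its braid automorphisms *)

Section FreeGroup.
Variable n : nat.
Implicit Types (x y : letter n) (u v w : word n) (f g : 'I_n -> word n).

Lemma linvK : involutive (@linv n).
Proof. by case=> i b; rewrite /linv /= negbK. Qed.

Lemma reduced_push x w : reduced w -> reduced (push x w).
Proof.
case: w => [|y w] //= /andP[yw rw].
by case: eqP => //= /eqP-> /=; rewrite yw.
Qed.

Lemma reduced_reduce w : reduced (reduce w).
Proof. by elim: w => //= x w IH; apply: reduced_push. Qed.

Lemma reduce_id w : reduced w -> reduce w = w.
Proof.
elim: w => //= x w IH /andP[xw rw]; rewrite IH //.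
by case: w xw {IH rw} => //= y w /negPf->.
Qed.

(** Van der Waerden's argument: a letter and its inverse act on reduced words by inverse
    permutations, so the action of a word depends only on its class in the free group. *)
Lemma pushK x w : reduced w -> push x (push (linv x) w) = w.
Proof.
case: w => [|y w] /=; first by rewrite eqxx.
case: eqP => [->|] /=; last by rewrite eqxx.
by rewrite !linvK; case: w => [|z w] //= /andP[/negPf->].
Qed.

Lemma foldr_push_reduce w u : reduced w -> foldr push w (reduce u) = foldr push w u.
Proof.
move=> rw; elim: u => //= x u <-.
case: (reduce u) => [|y r] //=; case: eqP => //= ->.
by rewrite pushK //; elim: r => //= z r; apply: reduced_push.
Qed.

(** Equality in the free group; the inductive wrapper keeps rewriting from unfolding it to an
    equality of normal forms. *)
Inductive eqv u v : Prop := Eqv of reduce u = reduce v.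

Lemma eqvP u v : eqv u v <-> reduce u = reduce v.
Proof. by split=> [[]|/Eqv]. Qed.

#[export] Instance eqv_equiv : Equivalence eqv.
Proof. by split=> [u|u v|u v w]; rewrite !eqvP // => ->. Qed.

#[export] Instance cat_eqv : Proper (eqv ==> eqv ==> eqv) (@cat (letter n)).
Proof.
move=> u u' /eqvP uu' v v' /eqvP vv'; rewrite eqvP /reduce !foldr_cat -!/(reduce _) vv'.
by rewrite -(foldr_push_reduce u) ?uu' ?foldr_push_reduce ?reduced_reduce.
Qed.

Lemma eqv_reduce w : eqv (reduce w) w.
Proof. by rewrite eqvP reduce_id // reduced_reduce. Qed.

Lemma winvM u v : winv (u ++ v) = winv v ++ winv u.
Proof. by rewrite /winv map_cat rev_cat. Qed.

Lemma winvK : involutive (@winv n).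
Proof.
by move=> w; rewrite /winv map_rev revK -map_comp map_id_in // => x _; apply: linvK.
Qed.

Lemma eqv_Vr u : eqv (u ++ winv u) [::].
Proof.
elim: u => //= x u IH.
rewrite -cat1s -[x :: u]cat1s winvM !catA -(catA [:: x]) IH cats0.
by rewrite eqvP /= eqxx.
Qed.

Lemma eqv_Vl u : eqv (winv u ++ u) [::].
Proof. by rewrite -{2}(winvK u) eqv_Vr. Qed.

Lemma eqv_K u v : eqv (u ++ winv u ++ v) v.
Proof. by rewrite catA eqv_Vr. Qed.

Lemma eqv_VK u v : eqv (winv u ++ u ++ v) v.
Proof. by rewrite catA eqv_Vl. Qed.

#[export] Instance winv_eqv : Proper (eqv ==> eqv) (@winv n).
Proof.
move=> u v uv; rewrite -[winv u]cats0 -(eqv_Vr v) catA.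
by have -> : eqv (winv u ++ v) [::] by rewrite -uv eqv_Vl.
Qed.

(** * Substitutions as endomorphisms *)

Definition hom f w : word n :=
  flatten [seq (if l.2 then winv (f l.1) else f l.1) | l <- w].

Lemma hom_cat f u v : hom f (u ++ v) = hom f u ++ hom f v.
Proof. by rewrite /hom map_cat flatten_cat. Qed.

Lemma hom1 f x : hom f [:: x] = if x.2 then winv (f x.1) else f x.1.
Proof. by rewrite /hom /= cats0. Qed.

Lemma hom_gen f i : hom f (gen i) = f i.
Proof. exact: hom1. Qed.

Lemma hom_winv f u : hom f (winv u) = winv (hom f u).
Proof.
elim: u => // x u IH; rewrite -cat1s winvM !hom_cat IH winvM; congr (_ ++ _).
by rewrite hom1 {IH u}; case: x => i [] /=; rewrite hom1 /= ?winvK.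
Qed.

Lemma hom_reduce f u : eqv (hom f (reduce u)) (hom f u).
Proof.
elim: u => //= x u IH; rewrite -[x :: u]cat1s hom_cat -IH.
case: (reduce u) => [|y r] //=; first by rewrite cats0.
case: eqP => [->|_]; last by rewrite -cat1s hom_cat.
rewrite -[linv x :: r]cat1s hom_cat.
have -> : [:: linv x] = winv [:: x] by [].
by rewrite hom_winv eqv_K.
Qed.

#[export] Instance hom_eqv f : Proper (eqv ==> eqv) (hom f).
Proof. by move=> u v /eqvP uv; rewrite -hom_reduce uv hom_reduce. Qed.

Lemma hom_ext f g w : (forall i, eqv (f i) (g i)) -> eqv (hom f w) (hom g w).
Proof.
move=> fg; elim: w => // x w IH; rewrite -cat1s !hom_cat IH !hom1.
by case: x.2; rewrite fg.
Qed.

Lemma hom_comp f g w : hom f (hom g w) = hom (fun i => hom f (g i)) w.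
Proof.
elim: w => // x w IH; rewrite -cat1s !hom_cat IH !hom1.
by case: x.2; rewrite ?hom_winv cats0.
Qed.

Lemma hom_id w : hom (@gen n) w = w.
Proof.
by elim: w => // x w IH; rewrite -cat1s hom_cat IH hom1; case: x => i [].
Qed.

Lemma reduce_gen (i : 'I_n) : reduce (gen i) = gen i.
Proof. by []. Qed.

Lemma reduced_map_pos (s : seq 'I_n) : reduced [seq (i, false) | i <- s].
Proof. by elim: s => //= i [|j s] //= ->; rewrite andbT xpair_eqE andbF. Qed.

Lemma reduced_tprod k : reduced (tprod n k).
Proof. exact: reduced_map_pos. Qed.

(** * Conjugacy, the braid group and its orbits *)

Definition conjv u v := exists c, eqv (winv c ++ u ++ c) v.

Lemma conjv_trans u v w : conjv u v -> conjv v w -> conjv u w.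
Proof.
move=> [c cE] [d dE]; exists (c ++ d).
by rewrite winvM -!catA -dE -cE -!catA.
Qed.

Lemma conjv_sym u v : conjv u v -> conjv v u.
Proof.
move=> [c cE]; exists (winv c).
by rewrite winvK -cE -!catA eqv_K eqv_Vr cats0.
Qed.

Lemma conjv_fl f u v : conjv u v -> conjv (hom f u) (hom f v).
Proof. by move=> [c cE]; exists (hom f c); rewrite -cE !hom_cat hom_winv. Qed.

Lemma eqv_conjv u v : eqv u v -> conjv u v.
Proof. by exists [::]; rewrite cats0. Qed.

(** [in_Bn] up to free reduction, with [z1] replaced by its inverse, the product of all
    generators. *)
Definition braid f :=
  [/\ exists g, (forall i, eqv (hom g (f i)) (gen i)) /\
                (forall i, eqv (hom f (g i)) (gen i)),
      eqv (hom f (tprod n n)) (tprod n n) &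
      exists s : {perm 'I_n}, forall i, conjv (f i) (gen (s i))].

Lemma braid_in_Bn f : braid f <-> in_Bn f.
Proof.
have rz : reduced (z1 n).
  rewrite /z1 /winv /tprod -map_comp -map_rev.
  by elim: (rev _) => //= i [|j s] //= ->; rewrite andbT xpair_eqE andbF.
split=> -[[g [gf fg]] fz [s fs]].
- split; first by exists g; split=> i; rewrite /subst -/(hom _ _) -[RHS]reduce_gen -eqvP.
  + rewrite /subst -/(hom _ _) -[RHS]reduce_id // -eqvP.
    by rewrite /z1 hom_winv fz.
  + exists s => i; have [c cE] := fs i; exists c.
    by rewrite -[RHS]reduce_gen -eqvP -cE /subst -/(hom _ _) eqv_reduce hom_gen.
- split; first by exists g; split=> i; rewrite eqvP reduce_gen; [apply: gf|apply: fg].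
  + rewrite -(winvK (tprod n n)) hom_winv -/(z1 n).
    suff -> : eqv (hom f (z1 n)) (z1 n) by [].
    by rewrite -{2}fz /subst eqv_reduce.
  + exists s => i; have [c cE] := fs i; exists c.
    by rewrite -cE eqv_reduce /subst -/(hom _ _) eqv_reduce hom_gen.
Qed.

Lemma braid_id : braid (@gen n).
Proof.
split; first by exists (@gen n); split=> i; rewrite hom_gen.
- by rewrite hom_id.
- by exists 1%g => i; rewrite perm1; apply: eqv_conjv.
Qed.

Lemma hom_cancel f g w : (forall i, eqv (hom f (g i)) (gen i)) -> eqv (hom f (hom g w)) w.
Proof. by move=> fg; rewrite hom_comp (hom_ext (g := @gen n)) // hom_id. Qed.

Lemma braid_comp f g : braid f -> braid g -> braid (fun i => hom f (g i)).
Proof.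
move=> [[f' [f'f ff']] fz [s fs]] [[g' [g'g gg']] gz [t gt]]; split.
- exists (fun i => hom g' (f' i)); split=> i; rewrite -!hom_comp.
  + by rewrite (hom_cancel _ f'f) g'g.
  + by rewrite (hom_cancel _ gg') ff'.
- by rewrite -hom_comp gz fz.
- exists (t * s)%g => i; rewrite permM; apply: conjv_trans (fs (t i)).
  by rewrite -[f (t i)]hom_gen; apply: conjv_fl.
Qed.

Lemma braid_inv f : braid f ->
  exists g, braid g /\ forall w, eqv (hom g (hom f w)) w.
Proof.
move=> [[g [gf fg]] fz [s fs]]; exists g; split; last by move=> w; apply: hom_cancel.
split; first by exists f.
- by rewrite -{1}fz hom_cancel.
- exists (s^-1)%g => i; apply: conjv_sym; set j := (s^-1 i)%g.
  have -> : g i = hom g (gen (s j)) by rewrite hom_gen permKV.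
  apply: conjv_trans (conjv_fl g (fs j)).
  by apply: eqv_conjv; rewrite gf.
Qed.

Definition orb u v := exists f, braid f /\ eqv (hom f u) v.

#[export] Instance orb_equiv : Equivalence orb.
Proof.
split=> [u|u v [f [bf fE]]|u v w [f [bf fE]] [g [bg gE]]].
- by exists (@gen n); split; [apply: braid_id|rewrite hom_id].
- by have [g [bg gf]] := braid_inv bf; exists g; split=> //; rewrite -fE gf.
- exists (fun i => hom g (f i)); split; first exact: braid_comp.
  by rewrite -hom_comp fE gE.
Qed.

#[export] Instance orb_eqv : Proper (eqv ==> eqv ==> iff) orb.
Proof.
move=> u u' uu' v v' vv'; split=> -[f [bf fE]]; exists f; split=> //.
- by rewrite -uu' fE.
- by rewrite uu' fE vv'.
Qed.

Lemma orb_in_Bn_orbit u k : orb u (tprod n k) <-> in_Bn_orbit u (tprod n k).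
Proof.
split=> -[f [/braid_in_Bn bf fE]]; exists f; split=> //.
- by rewrite /subst -/(hom _ _) -[RHS]reduce_id ?reduced_tprod // -eqvP.
- by rewrite -fE /subst eqv_reduce.
Qed.

Lemma tprodS k (lt_kn : k < n) :
  tprod n k.+1 = tprod n k ++ gen (Ordinal lt_kn).
Proof.
rewrite /tprod (take_nth (Ordinal lt_kn)) ?size_enum_ord // map_rcons -cats1.
by congr (_ ++ [:: (_, _)]); apply: val_inj; rewrite /= nth_enum_ord.
Qed.

(** * The exponent sum, a braid invariant *)

Definition expsum w : int := (\sum_(x <- w) (if x.2 then -1 else 1))%R.

Import GRing.Theory.

Lemma expsum_cat u v : expsum (u ++ v) = (expsum u + expsum v)%R.
Proof. exact: big_cat. Qed.

Lemma expsum_winv u : expsum (winv u) = (- expsum u)%R.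
Proof.
elim: u => [|x u IH]; first by rewrite /expsum big_nil oppr0.
rewrite -cat1s winvM !expsum_cat IH opprD addrC; congr (_ + _)%R.
by rewrite /expsum !big_seq1 /=; case: x.2 => //=; rewrite opprK.
Qed.

Lemma expsum_reduce u : expsum (reduce u) = expsum u.
Proof.
elim: u => //= x u IH; rewrite -[x :: u]cat1s expsum_cat -IH.
case: (reduce u) => [|y r] /=; first by rewrite -expsum_cat.
case: eqP => [->|_]; last by rewrite -expsum_cat.
have -> : linv x :: r = winv [:: x] ++ r by [].
by rewrite expsum_cat expsum_winv addrA subrr add0r.
Qed.

Lemma eqv_expsum u v : eqv u v -> expsum u = expsum v.
Proof. by move=> /eqvP uv; rewrite -expsum_reduce uv expsum_reduce. Qed.

Lemma expsum_fl f u : braid f -> expsum (hom f u) = expsum u.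
Proof.
move=> [_ _ [s fs]]; have f1 i : expsum (f i) = 1%R.
  have [c /eqv_expsum] := fs i; rewrite !expsum_cat expsum_winv addrC addrK => ->.
  by rewrite /expsum big_seq1.
elim: u => // x u IH; rewrite -cat1s hom_cat hom1 !expsum_cat IH; congr (_ + _)%R.
by rewrite /expsum big_seq1; case: x.2; rewrite -/(expsum _) ?expsum_winv f1.
Qed.

Lemma orb_expsum u v : orb u v -> expsum u = expsum v.
Proof. by move=> [f [bf /eqv_expsum<-]]; rewrite expsum_fl. Qed.

Lemma expsum_tprod k : k <= n -> expsum (tprod n k) = k%:R%R.
Proof.
elim: k => [|k IH] kn; first by rewrite /tprod take0 /expsum big_nil.
by rewrite tprodS expsum_cat IH ?(ltnW kn) // /expsum big_seq1 -natr1.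
Qed.

(** * Artin generators and the shifts composed from them *)

Section Sigma.
Variables i j : 'I_n.
Hypothesis ij : j = i.+1 :> nat.

(** Artin's generator: the images of t_i and t_j still multiply to t_i t_j, so the only prefix
    product that changes is the one ending between these two letters. *)
Definition sigma (k : 'I_n) : word n :=
  if k == i then gen j
  else if k == j then winv (gen j) ++ gen i ++ gen j else gen k.

Definition sigmaV (k : 'I_n) : word n :=
  if k == j then gen i
  else if k == i then gen i ++ gen j ++ winv (gen i) else gen k.

Lemma neq_ji : (j == i) = false.
Proof. by apply/eqP => e; move: ij; rewrite e; lia. Qed.

Lemma sigmaK k : eqv (hom sigmaV (sigma k)) (gen k).
Proof.
rewrite /sigma; case: eqP => [->|/eqP ki].
  by rewrite hom_gen /sigmaV eqxx.
case: eqP => [->|/eqP kj].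
  rewrite !hom_cat hom_winv !hom_gen /sigmaV eqxx (eq_sym i) neq_ji eqxx.
  by rewrite -!catA eqv_VK eqv_Vl cats0.
by rewrite hom_gen /sigmaV (negPf ki) (negPf kj).
Qed.

Lemma sigmaVK k : eqv (hom sigma (sigmaV k)) (gen k).
Proof.
rewrite /sigmaV; case: eqP => [->|/eqP ki].
  by rewrite hom_gen /sigma eqxx.
case: eqP => [->|/eqP kj].
  rewrite !hom_cat hom_winv !hom_gen /sigma eqxx neq_ji eqxx.
  by rewrite -!catA eqv_K eqv_Vr cats0.
by rewrite hom_gen /sigma (negPf ki) (negPf kj).
Qed.

Lemma sigma_tprod_le k : k <= i -> hom sigma (tprod n k) = tprod n k.
Proof.
elim: k => [|k IH] lt_ki; first by rewrite /tprod take0.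
have kn : k < n by apply: ltn_trans (ltn_ord i).
rewrite tprodS hom_cat IH ?(ltnW lt_ki) // hom_gen /sigma -!val_eqE /= ij.
by rewrite !ltn_eqF // ltnW.
Qed.

Lemma sigma_tprodS : hom sigma (tprod n i.+1) = tprod n i ++ gen j.
Proof.
rewrite (tprodS (ltn_ord i)) hom_cat sigma_tprod_le // hom_gen /sigma.
by rewrite -val_eqE eqxx.
Qed.

Lemma sigma_tprod k : k != i.+1 -> k <= n -> eqv (hom sigma (tprod n k)) (tprod n k).
Proof.
case: (leqP k i) => [ki _ _|]; first by rewrite sigma_tprod_le.
elim: k => // k IH ki ik kn; rewrite tprodS hom_cat hom_gen.
have [k_eq | ki2] := eqVneq k i.+1.
  have -> : Ordinal kn = j by apply: val_inj; rewrite /= ij.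
  rewrite {1}k_eq sigma_tprodS /sigma neq_ji eqxx -!catA eqv_K k_eq.
  rewrite (tprodS (ltn_ord i)) -catA.
  by have -> : Ordinal (ltn_ord i) = i by apply: val_inj.
rewrite IH ?(ltnW kn) //; last by lia.
by rewrite /sigma -!val_eqE /= ij (negPf ki2) -eqSS (negPf ik).
Qed.

Lemma braid_sigma : braid sigma.
Proof.
split; first by exists sigmaV; split=> k; [apply: sigmaK|apply: sigmaVK].
- apply: sigma_tprod => //; rewrite -ij; apply/eqP => e.
  by move: (ltn_ord j); rewrite -e ltnn.
- exists (tperm i j) => k; rewrite /sigma; case: tpermP => [->|->|/eqP ki /eqP kj].
  + by rewrite eqxx; apply: eqv_conjv.
  + rewrite neq_ji eqxx; by apply: conjv_sym; exists (gen j).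
  + by rewrite (negPf ki) (negPf kj); apply: eqv_conjv.
Qed.
End Sigma.

(* The braid pulling the puncture b+1 leftwards, below the punctures a+1, ..., b. *)
Lemma braid_shift a b : a <= b -> b < n -> exists f, [/\ braid f,
  forall k, k <= n -> (k <= a) || (b < k) -> eqv (hom f (tprod n k)) (tprod n k) &
  forall k, a <= k <= b ->
    eqv (hom f (tprod n k)) (tprod n a ++ winv (tprod n a.+1) ++ tprod n k.+1)].
Proof.
elim: b => [|b IH]; rewrite leq_eqVlt => /predU1P[-> b_lt|].
- exists (@gen n); split=> [|k _ _|k kb]; first exact: braid_id.
    by rewrite hom_id.
  have -> : k = 0 by lia.
  by rewrite hom_id eqv_Vl cats0.
- by [].
- exists (@gen n); split=> [|k _ _|k kb]; first exact: braid_id.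
    by rewrite hom_id.
  have -> : k = b.+1 by lia.
  by rewrite hom_id eqv_Vl cats0.
move=> ab bn; have bn' := ltnW bn; have [f [bf f_out f_in]] := IH ab bn'.
pose s := sigma (Ordinal bn') (Ordinal bn).
have sE k : k != b.+1 -> k <= n -> eqv (hom s (tprod n k)) (tprod n k).
  exact: (@sigma_tprod (Ordinal bn') (Ordinal bn) erefl).
exists (fun i => hom f (s i)); split=> [|k kn k_out|k k_in].
- by apply: braid_comp => //; apply: braid_sigma.
- rewrite -hom_comp sE //; last by lia.
  by apply: f_out => //; lia.
- rewrite -hom_comp; have [->|kb] := eqVneq k b.+1; last first.
    by rewrite sE ?f_in //; lia.
  rewrite sigma_tprodS //= hom_cat f_in; last by lia.
  (* [s] has turned P_(b+1) into P_b times this letter. The letter is a quotient of two prefixes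
     outside [a, b], so [f] fixes it. *)
  have -> : eqv (gen (Ordinal bn)) (winv (tprod n b.+1) ++ tprod n b.+2).
    by rewrite (tprodS bn) eqv_VK.
  rewrite hom_cat hom_winv !f_out //; try lia.
  by rewrite -!catA eqv_K.
Qed.
End FreeGroup.

(** * Arcs in the punctured plane *)

Section Meander.
Implicit Types (e : nat * nat) (bs : seq (nat * nat)) (c : nat -> nat).

Definition nest e e' := nested e.1 e.2 e'.1 e'.2.

(** A point other than a and b lies between them exactly when its comparisons with a and with b
    differ; the exclusive or avoids ordering the pair. *)
Lemma nestE a b a' b' : nest (a, b) (a', b') =
  [&& a != b, a' != b', a != a', a != b', b != a', b != b' &
      ((a < a') (+) (b < a')) == ((a < b') (+) (b < b'))].
Proof. rewrite /nest /nested /between /= !inE; lia. Qed.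

Lemma nest_sym : ssrbool.symmetric nest.
Proof. by move=> [a b] [a' b']; rewrite !nestE; lia. Qed.

(** Makes the intervals bounded by a lower half-arc, with or without their ends, regions that no
    other lower half-arc leaves. *)
Lemma nest_ltn a b u v : a < b -> nest (a, b) (u, v) \/ nest (b, a) (u, v) ->
  (a < u < b) = (a < v < b) /\ (a <= u <= b) = (a <= v <= b).
Proof.
move=> ab nuv; have {nuv} : nest (a, b) (u, v).
  by case: nuv; rewrite // !nestE addbC [(b < v) (+) _]addbC; lia.
rewrite nestE => /and5P[_ _ au av /and3P[bu bv]].
by move=> H; split; lia.
Qed.

(* [bs] lists the lower half-arcs in the order in which the arc from S to E runs
   through them; the upper half-arcs are then determined. *)
Fixpoint tops S bs E : seq (nat * nat) :=
  if bs is (u, v) :: bs' then (S, u) :: tops v bs' E else [:: (S, E)].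

Lemma tops_cat S bs1 u v bs2 E :
  tops S (bs1 ++ (u, v) :: bs2) E = tops S bs1 u ++ tops v bs2 E.
Proof. by elim: bs1 S => //= -[a b] bs1 IH S; rewrite IH. Qed.

Definition pts bs := flatten [seq [:: e.1; e.2] | e <- bs].

Lemma pts_cat bs1 bs2 : pts (bs1 ++ bs2) = pts bs1 ++ pts bs2.
Proof. by rewrite /pts map_cat flatten_cat. Qed.

Lemma mem_pts bs u v : (u, v) \in bs -> u \in pts bs /\ v \in pts bs.
Proof.
move=> uv; split; apply/flattenP; exists [:: u; v]; rewrite ?inE ?eqxx ?orbT //;
by apply/mapP; exists (u, v).
Qed.

Lemma ptsP bs x : x \in pts bs ->
  exists bs1 e bs2, bs = bs1 ++ e :: bs2 /\ (x = e.1 \/ x = e.2).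
Proof.
case/flattenP=> s /mapP[e e_in ->]; rewrite !inE => x_e.
case/path.splitPr: e_in => bs1 bs2; exists bs1, e, bs2; split=> //.
by case/orP: x_e => /eqP->; [left|right].
Qed.

Lemma pairwise_mem (T : eqType) (r : rel T) (s : seq T) x y : ssrbool.symmetric r ->
  pairwise r s -> x \in s -> y \in s -> x != y -> r x y.
Proof.
move=> rs; elim: s => //= z s IH /andP[/allP zs ps].
rewrite !inE => /predU1P[->|xs] /predU1P[->|ys]; first by rewrite eqxx.
- by move=> _; apply: zs.
- by move=> _; rewrite rs; apply: zs.
- exact: IH.
Qed.

(** The conditions on [c] concern the ends of lower half-arcs, the only labels that the word reads.
    They say that [c] can count punctures to the left. *)
Record meander n S E c bs : Prop := Meander {
  pts_in : forall x, x \in pts bs -> S < x < E;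
  bot_nest : pairwise nest bs;
  top_nest : pairwise nest (tops S bs E);
  lab_mono : {in pts bs &, {homo c : x y / x < y >-> x <= y}};
  lab_le : {in pts bs, forall x, c x <= n} }.

(** No point of [bs] separates p from q, whichever of the two is on the left. *)
Definition adjacent bs p q :=
  {in pts bs, forall x, x != p -> x != q -> (x < p) = (x < q)}.

(** Descent on |p - q|, written [p + q - (minn p q).*2]: a point between p and q is an end of
    another upper half-arc, which by nesting lies wholly between them and is shorter. It avoids S
    and E, which lie outside. *)
Lemma innermost_top n S E c bs : meander n S E c bs -> 1 < size bs ->
  exists bs1 p' p q q' bs2,
    bs = bs1 ++ (p', p) :: (q, q') :: bs2 /\ adjacent bs p q.
Proof.
move=> [Hpts _ Htop _ _] sz.
have : exists d bs1 p' p q q' bs2,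
    bs = bs1 ++ (p', p) :: (q, q') :: bs2 /\ p + q - (minn p q).*2 = d.
  case: bs sz {Hpts Htop} => [|[p' p] [|[q q'] bs2]] // _.
  by exists (p + q - (minn p q).*2), [::], p', p, q, q', bs2.
case=> d; elim/ltn_ind: d => d IH [bs1 [p' [p [q [q' [bs2 [bsE dE]]]]]]].
have p_in : p \in pts bs by rewrite bsE pts_cat mem_cat !inE eqxx !orbT.
have q_in : q \in pts bs by rewrite bsE pts_cat mem_cat !inE eqxx !orbT.
have pq_top : (p, q) \in tops S bs E by rewrite bsE tops_cat /= mem_cat inE eqxx orbT.
have [/allP inn|/allPn[x x_in]] :=
  boolP (all (fun x => (x != p) ==> (x != q) ==> ((x < p) == (x < q))) (pts bs)).
  exists bs1, p', p, q, q', bs2; split=> // x /inn.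
  by case: eqP => //= _; case: eqP => //= _ /eqP.
rewrite !negb_imply => /and3P[xp xq x_btw].
have pS := Hpts _ p_in; have qS := Hpts _ q_in; have xS := Hpts _ x_in.
have key a b : (a, b) \in tops S bs E -> (x = a) \/ (x = b) -> nest (p, q) (a, b).
  move=> ab_in ab; apply: (pairwise_mem nest_sym Htop) => //.
  by apply/eqP => -[pa qb]; case: ab => xE; move: xp xq; rewrite xE pa qb eqxx.
have [b1 [[u v] [b2 [bsE' /= xE]]]] := ptsP x_in.
(* If x starts a lower half-arc, its upper half-arc comes from the preceding lower one, or from S;
   if x ends one, it leads to the next, or to E. *)
case: xE => xE; subst x.
- case/lastP: b1 bsE' => [|b1 [r' r]] bsE'.
    have := key S u; rewrite {1}bsE' /= inE eqxx => /(_ isT (or_intror erefl)).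
    by rewrite nestE; lia.
  have ru : (r, u) \in tops S bs E.
    by rewrite bsE' cat_rcons tops_cat mem_cat inE eqxx orbT.
  move: (key _ _ ru (or_intror erefl)); rewrite nestE => nst.
  apply: (IH (r + u - (minn r u).*2)); first by lia.
  by exists b1, r', r, u, v, b2; rewrite bsE' cat_rcons.
- case: b2 bsE' => [|[r r'] b2] bsE'.
    have := key v E; rewrite {1}bsE' tops_cat mem_cat inE eqxx orbT.
    by move=> /(_ isT (or_introl erefl)); rewrite nestE; lia.
  have vr : (v, r) \in tops S bs E.
    by rewrite bsE' tops_cat mem_cat inE eqxx orbT.
  move: (key _ _ vr (or_introl erefl)); rewrite nestE => nst.
  apply: (IH (v + r - (minn v r).*2)); first by lia.
  by exists b1, u, v, r, r', b2; rewrite bsE'.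
Qed.

(** * Words of meanders, carrying punctures and deleting points *)

Definition meander_word n c bs : word n :=
  flatten [seq winv (tprod n (c e.1)) ++ tprod n (c e.2) | e <- bs].

(* The puncture b+1, lying just right of the points of I, moves to just left of them. *)
Lemma orb_shift_up n c bs (I : pred nat) a b : a <= b -> b < n ->
  {in bs, forall e, I e.1 = I e.2} ->
  {in pts bs, forall x, c x <= n} ->
  {in pts bs, forall x, if I x then a <= c x <= b else (c x <= a) || (b < c x)} ->
  orb (meander_word n c bs) (meander_word n (fun x => c x + I x) bs).
Proof.
move=> ab bn Ibs cn cI; have [f [bf f_out f_in]] := braid_shift ab bn.
exists f; split=> //.
elim: bs Ibs cn cI => // -[u v] bs IH Ibs cn cI.
rewrite /meander_word /= hom_cat; apply: cat_eqv; last first.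
  apply: IH => [e e_in|x x_in|x x_in].
  - by apply: Ibs; rewrite inE e_in orbT.
  - by apply: cn; rewrite !inE x_in !orbT.
  - by apply: cI; rewrite !inE x_in !orbT.
have uin : u \in pts ((u, v) :: bs) by rewrite !inE eqxx.
have vin : v \in pts ((u, v) :: bs) by rewrite !inE eqxx orbT.
have := Ibs (u, v) (mem_head _ _); rewrite /= => Iuv.
have := cI _ uin; have := cI _ vin; rewrite hom_cat hom_winv -Iuv.
(* With both ends in the region, the two factors P_a P_(a+1)^-1 brought in by the braid cancel; this
   is why no half-arc may leave the region. *)
case: (I u) => cv cu; rewrite ?addn1 ?addn0.
  by rewrite !f_in // !winvM -!catA winvK eqv_VK eqv_K.
by rewrite !f_out //; apply: cn.
Qed.

Lemma orb_shift_down n c bs (I : pred nat) a b : a <= b -> b < n ->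
  {in bs, forall e, I e.1 = I e.2} ->
  {in pts bs, forall x, c x <= n} ->
  {in pts bs, forall x, if I x then a < c x <= b.+1 else (c x <= a) || (b < c x)} ->
  orb (meander_word n c bs) (meander_word n (fun x => c x - I x) bs).
Proof.
move=> ab bn Ibs cn cI; symmetry.
(* The truncated subtraction is exact, since labels in the region exceed a. The claim is then the
   inverse of an upward shift. *)
have -> : meander_word n c bs = meander_word n (fun x => (c x - I x) + I x) bs.
  congr flatten; apply/eq_in_map => -[u v] e_in /=.
  have [uin vin] := mem_pts e_in.
  move: (cI _ uin) (cI _ vin).
  case: (I u); case: (I v) => ? ?; rewrite ?subn0 ?addn0 ?subnK //; lia.
apply: (orb_shift_up ab bn) => // x x_in.
- by apply: leq_trans (cn _ x_in); rewrite leq_subr.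
- by have := cI _ x_in; case: (I x); lia.
Qed.

(** Labels right of the interval are at least b+1, so raising those inside by one keeps the labels
    monotone and bounded by n. *)
Lemma meander_shift_up n S E c bs l r a b : meander n S E c bs ->
  a <= b -> b < n ->
  {in bs, forall e, (l <= e.1 <= r) = (l <= e.2 <= r)} ->
  {in pts bs, forall x, (x < l -> c x <= a) /\
    (l <= x <= r -> a <= c x <= b) /\ (r < x -> b < c x)} ->
  let c' := fun x => c x + (l <= x <= r) in
  meander n S E c' bs /\ orb (meander_word n c bs) (meander_word n c' bs).
Proof.
move=> [Hpts Hbot Htop Hmon Hle] ab bn Ibs cI c'; split.
- split=> // [x y x_in y_in xy|x x_in]; rewrite /c'.
  + by have := Hmon _ _ x_in y_in xy; have := cI _ x_in; have := cI _ y_in; lia.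
  + by have := Hle _ x_in; have := cI _ x_in; lia.
- apply: (orb_shift_up ab bn) => // x x_in.
  by have := cI _ x_in; case: ifP; lia.
Qed.

Lemma meander_shift_down n S E c bs l r a b : meander n S E c bs ->
  a <= b -> b < n ->
  {in bs, forall e, (l <= e.1 <= r) = (l <= e.2 <= r)} ->
  {in pts bs, forall x, (x < l -> c x <= a) /\
    (l <= x <= r -> a < c x <= b.+1) /\ (r < x -> b < c x)} ->
  let c' := fun x => c x - (l <= x <= r) in
  meander n S E c' bs /\ orb (meander_word n c bs) (meander_word n c' bs).
Proof.
move=> [Hpts Hbot Htop Hmon Hle] ab bn Ibs cI c'; split.
- split=> // [x y x_in y_in xy|x x_in]; rewrite /c'.
  + by have := Hmon _ _ x_in y_in xy; have := cI _ x_in; have := cI _ y_in; lia.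
  + by have := Hle _ x_in; have := cI _ x_in; lia.
- apply: (orb_shift_down ab bn) => // x x_in.
  by have := cI _ x_in; case: ifP; lia.
Qed.

(* The region below the segment between p and q also touches the line just beyond p',
   and a puncture of the segment is moved there, following the arc (p', p). *)
Lemma meander_move n S E c bs bs1 p' p q q' bs2 : meander n S E c bs ->
  bs = bs1 ++ (p', p) :: (q, q') :: bs2 -> adjacent bs p q -> c p != c q ->
  exists c', [/\ meander n S E c' bs,
    orb (meander_word n c bs) (meander_word n c' bs) &
    maxn (c' p) (c' q) - minn (c' p) (c' q) < maxn (c p) (c q) - minn (c p) (c q)].
Proof.
move=> mb bsE adj cpq; have [Hpts Hbot Htop Hmon Hle] := mb.
have arc1 : (p', p) \in bs by rewrite bsE mem_cat !inE eqxx !orbT.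
have arc2 : (q, q') \in bs by rewrite bsE mem_cat !inE eqxx !orbT.
have [p'_in p_in] := mem_pts arc1; have [q_in q'_in] := mem_pts arc2.
have bot e : e \in bs -> e = (p', p) \/ nest (p', p) e.
  move=> e_in; have [|ne] := eqVneq e (p', p); first by left.
  by right; apply: (pairwise_mem nest_sym Hbot); rewrite // eq_sym.
have : nest (p', p) (q, q').
  rewrite bsE pairwise_cat /= in Hbot.
  by case/and4P: Hbot => _ _ /andP[].
rewrite nestE => /and5P[p'p _ p'q _ /andP[pNq _]].
have mono x y : x \in pts bs -> y \in pts bs -> x <= y -> c x <= c y.
  by move=> xi yi; rewrite leq_eqVlt => /predU1P[->//|]; apply: Hmon.
have cp := Hle _ p_in; have cq := Hle _ q_in; have cp' := Hle _ p'_in.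
have [pq|qp] : p < q \/ q < p by lia.
- have cpq' : c p < c q by have := mono _ _ p_in q_in (ltnW pq); lia.
  have [lt_p'p|lt_pp'] : p' < p \/ q < p' by have := adj _ p'_in; lia.
  (* The puncture just right of p passes around the arc to the left of p'; the label of p rises. *)
  + have [||e e_in|x x_in|mb' ob] := meander_shift_up (l := p') (r := p)
        (a := c p') (b := c p) mb.
    * exact: mono (ltnW lt_p'p).
    * exact: leq_trans cq.
    * have [->/=|] := bot _ e_in; first by lia.
      case: e {e_in} => u v /= H.
      by have [] := @nest_ltn p' p u v _ _; rewrite ?H; auto; lia.
    * have := adj _ x_in; have := mono _ _ x_in p_in; have := mono _ _ q_in x_in.
      by have := mono _ _ x_in p'_in; have := mono _ _ p'_in x_in; lia.
    * by eexists; split; [exact: mb'|exact: ob|rewrite /=; lia].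
  (* The segment lies under the arc: the puncture just left of q moves to just left of p', and the
     label of q falls. The ends p and p' are excluded. *)
  + have [||e e_in|x x_in|mb' ob] := meander_shift_down (l := p.+1) (r := p'.-1)
        (a := (c q).-1) (b := (c p').-1) mb.
    * by have := mono _ _ q_in p'_in (ltnW lt_pp'); lia.
    * by have := mono _ _ q_in p'_in (ltnW lt_pp'); lia.
    * have [->/=|] := bot _ e_in; first by lia.
      case: e {e_in} => u v /= H.
      by have [] := @nest_ltn p p' u v _ _; rewrite ?H; auto; lia.
    * have := adj _ x_in; have := mono _ _ x_in p_in; have := mono _ _ q_in x_in.
      by have := mono _ _ x_in p'_in; have := mono _ _ p'_in x_in; lia.
    * by eexists; split; [exact: mb'|exact: ob|rewrite /=; lia].
(* Mirror images: the label of q rises if p' is beyond q, and that of p falls otherwise. *)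
- have cpq' : c q < c p by have := mono _ _ q_in p_in (ltnW qp); lia.
  have [lt_p'q|lt_pp'] : p' < q \/ p < p' by have := adj _ p'_in; lia.
  + have [||e e_in|x x_in|mb' ob] := meander_shift_up (l := p'.+1) (r := p.-1)
        (a := c p') (b := c q) mb.
    * exact: mono (ltnW lt_p'q).
    * exact: leq_trans cp.
    * have [->/=|] := bot _ e_in; first by lia.
      case: e {e_in} => u v /= H.
      by have [] := @nest_ltn p' p u v _ _; rewrite ?H; auto; lia.
    * have := adj _ x_in; have := mono _ _ p_in x_in; have := mono _ _ x_in q_in.
      by have := mono _ _ x_in p'_in; have := mono _ _ p'_in x_in; lia.
    * by eexists; split; [exact: mb'|exact: ob|rewrite /=; lia].
  + have [||e e_in|x x_in|mb' ob] := meander_shift_down (l := p) (r := p')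
        (a := (c p).-1) (b := (c p').-1) mb.
    * by have := mono _ _ p_in p'_in (ltnW lt_pp'); lia.
    * by have := mono _ _ p_in p'_in (ltnW lt_pp'); lia.
    * have [->/=|] := bot _ e_in; first by lia.
      case: e {e_in} => u v /= H.
      by have [] := @nest_ltn p p' u v _ _; rewrite ?H; auto; lia.
    * have := adj _ x_in; have := mono _ _ p_in x_in; have := mono _ _ x_in q_in.
      by have := mono _ _ x_in p'_in; have := mono _ _ p'_in x_in; lia.
    * by eexists; split; [exact: mb'|exact: ob|rewrite /=; lia].
Qed.

(** The nesting conditions of (p', p) and (q, q') with a third arc are parity conditions. Added
    modulo 2, the comparisons with p and q cancel by adjacency, leaving the condition for (p',
    q'). *)
Lemma meander_delete n S E c bs1 p' p q q' bs2 :
  let bs := bs1 ++ (p', p) :: (q, q') :: bs2 in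
  let bs' := bs1 ++ (p', q') :: bs2 in
  meander n S E c bs -> adjacent bs p q -> c p = c q ->
  meander n S E c bs' /\ eqv (meander_word n c bs) (meander_word n c bs').
Proof.
move=> bs bs' [Hpts Hbot Htop Hmon Hle] adj cpq.
have sub x : x \in pts bs' -> x \in pts bs.
  move=> x_in; rewrite /bs pts_cat mem_cat.
  move: x_in; rewrite /bs' pts_cat mem_cat => /orP[->//|].
  by rewrite !inE => /or3P[]->; rewrite ?orbT.
split; last first.
  rewrite /meander_word !map_cat !flatten_cat /= cpq -!catA.
  by rewrite eqv_K.
have Hbot0 := Hbot; rewrite pairwise_cat allrel_consr allrel_consr /= in Hbot0.
case/and4P: Hbot0 => /and3P[/allP l1 /allP l2 l3] pw1 /andP[p1 /allP r1] /andP[/allP r2 pw2].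
have adjn e : e \in bs -> nest (p', p) e -> nest (q, q') e -> nest (p', q') e.
  case: e => u v /mem_pts[/adj adju /adj adjv] nu nv.
  have adjV : (p < u) = (q < u) /\ (p < v) = (q < v).
    by move: nu nv; rewrite !nestE; lia.
  move: p1 nu nv adjV; rewrite !nestE.
  move=> /and5P[_ _ _ p'q' _] /and5P[_ uv p'u p'v /and3P[_ _ /eqP nu]].
  move=> /and5P[_ _ qu qv /and3P[q'u q'v /eqP nv]] [pqu pqv].
  rewrite p'q' uv p'u p'v q'u q'v /=; move: nu nv; rewrite pqu pqv.
  by case: (p' < u); case: (p' < v); case: (q < u); case: (q < v);
     case: (q' < u); case: (q' < v).
split=> [x /sub/Hpts//| | |x y /sub x_in /sub y_in|x /sub/Hle//]; last exact: Hmon.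
- rewrite pairwise_cat allrel_consr /= l3 pw1 pw2 !andbT; apply/andP; split.
  + apply/allP => e e_in; rewrite nest_sym; apply: adjn.
    * by rewrite mem_cat e_in.
    * by rewrite nest_sym; apply: l1.
    * by rewrite nest_sym; apply: l2.
  + apply/allP => e e_in; apply: adjn; [|exact: r1|exact: r2].
    by rewrite mem_cat !inE e_in !orbT.
(* The upper half-arcs merely lose (p, q). *)
- move: Htop; rewrite !tops_cat /=; apply: subseq_pairwise.
  exact: cat_subseq (subseq_refl _) (subseq_cons _ _).
Qed.

(** Each step carries the puncture just left of a single lower half-arc to just right of it,
    lowering both labels by one. *)
Lemma orb_tprod_interval n i j : i <= j -> j <= n ->
  orb (winv (tprod n i) ++ tprod n j) (tprod n (j - i)).
Proof.
elim: i j => [|i IH] j ij jn.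
  have -> : tprod n 0 = [::] by rewrite /tprod take0.
  by rewrite subn0; reflexivity.
case: j ij jn => // j ij jn; rewrite subSS -IH //; last exact: ltnW.
pose c x := if x is 0 then i.+1 else j.+1.
have := @orb_shift_down n c [:: (0, 1)] predT i j ij jn.
rewrite /meander_word /= !cats0 !subSS !subn0; apply=> [//||] x.
- by rewrite !inE /c; case: x => [|x] _; lia.
- by rewrite !inE /c; case: x => [|x] _ /=; lia.
Qed.

(** Outer induction on the number of lower half-arcs, inner one on the label gap between p and q;
    adjacency depends on positions alone and survives relabelling. *)
Lemma meander_orb n S E c bs : meander n S E c bs ->
  exists2 k, k <= n & orb (meander_word n c bs) (tprod n k).
Proof.
have [m] := ubnP (size bs); elim: m => // m IHm in c bs *; rewrite ltnS => sz mb.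
have [sz1|sz1] := leqP (size bs) 1.
  case: bs mb sz1 {sz} => [|[x y] [|//]] mb _.
    by exists 0 => //; rewrite /tprod take0; reflexivity.
  have [Hpts _ Htop Hmon Hle] := mb.
  have xi : x \in pts [:: (x, y)] by rewrite !inE eqxx.
  have yi : y \in pts [:: (x, y)] by rewrite !inE eqxx orbT.
  (* S and E are extreme, so nesting of (S, x) and (y, E) forces this order. *)
  have xy : x < y.
    by move: Htop (Hpts _ xi) (Hpts _ yi); rewrite /= !andbT nestE; lia.
  exists (c y - c x); first by apply: leq_trans (Hle _ yi); rewrite leq_subr.
  by rewrite /meander_word /= cats0; apply: orb_tprod_interval; [apply: Hmon|apply: Hle].
have [bs1 [p' [p [q [q' [bs2 [bsE adj]]]]]]] := innermost_top mb sz1.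
have [d] := ubnP (maxn (c p) (c q) - minn (c p) (c q)).
elim: d => // d IHd in c mb *; rewrite ltnS => cd.
have [cpq|cpq] := eqVneq (c p) (c q).
  rewrite bsE in mb adj sz *; have [mb' ww'] := meander_delete mb adj cpq.
  have [|k kn ok] := IHm _ _ _ mb'; last by exists k => //; rewrite ww'.
  by apply: leq_trans sz; rewrite !size_cat /= !addnS ltnS.
have [c' [mb' ob lt_d]] := meander_move mb bsE adj cpq.
have [|k kn ok] := IHd c' mb'; first exact: leq_trans cd.
by exists k => //; rewrite ob.
Qed.
End Meander.

(** * From planar words to arcs *)

Lemma uniq_pairwise (T : eqType) (r : rel T) (s : seq T) : uniq s ->
  {in s &, forall x y, x != y -> r x y} -> pairwise r s.
Proof.
elim: s => //= x s IH /andP[xs us] rs; apply/andP; split.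
  apply/allP => y ys; apply: rs; rewrite ?inE ?eqxx ?ys ?orbT //.
  by apply: contraNneq xs => ->.
by apply: IH => // y z ys zs; apply: rs; rewrite inE ?ys ?zs orbT.
Qed.

Lemma tops_iota (pi : nat -> nat) k m :
  tops (pi k.*2) [seq (pi i.*2.+1, pi i.*2.+2) | i <- iota k m] (pi (k + m).*2.+1) =
  [seq (pi i.*2, pi i.*2.+1) | i <- iota k m.+1].
Proof.
elim: m k => [|m IH] k /=; first by rewrite addn0.
by rewrite -addSnnS -doubleS IH.
Qed.

Section WhiteheadExpansion.
Variable n : nat.
Implicit Type w : word n.

Lemma size_wh_exp w : size (wh_exp w) = (size w).+1.*2.
Proof.
rewrite /= size_cat size_flatten /shape -map_comp addn1 /=.
by elim: w => //= a w IH; lia.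
Qed.

Lemma nth_wh_exp w i : i < size w ->
  nth 0 (wh_exp w) i.*2.+1 = nth 0 [seq code a | a <- w] i /\
  nth 0 (wh_exp w) i.*2.+2 = nth 0 [seq code (linv a) | a <- w] i.
Proof. by rewrite /wh_exp /=; elim: w i => // a w IH [|i] //= /IH. Qed.

Lemma nth_wh_exp_last w : nth 0 (wh_exp w) (size w).*2.+1 = n.*2.+1.
Proof. by rewrite /wh_exp /=; elim: w. Qed.

Lemma wh_exp_inner w k : 0 < k -> k < (size w).*2.+1 ->
  0 < nth 0 (wh_exp w) k < n.*2.+1.
Proof.
case: k => // k _; rewrite ltnS => kw; rewrite /wh_exp /= nth_cat.
have -> : size (flatten [seq [:: code a; code (linv a)] | a <- w]) = (size w).*2.
  by have := size_wh_exp w; rewrite /= size_cat /=; lia.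
rewrite kw; elim: w k kw => // a w IH.
have co (x : letter n) : 0 < code x < n.*2.+1.
  by rewrite /code; have := ltn_ord x.1; case: x.2 => /=; lia.
by case=> [|[|k]] //= ; rewrite ?doubleS ?ltnS => kw; rewrite ?IH ?co.
Qed.

(** Half a code counts the punctures left of the symbol: j for t_(j+1), and j+1 for its inverse. *)
Lemma eqv_letter (a : letter n) :
  eqv (winv (tprod n (code a)./2) ++ tprod n (code (linv a))./2) [:: a].
Proof.
case: a => -[j jn] [] /=; rewrite /code /= ?doubleK uphalf_double (tprodS jn).
  by rewrite winvM -catA eqv_Vl cats0.
by rewrite eqv_VK.
Qed.

Lemma planar_meander w : planar_seq (wh_exp w) ->
  exists S E c bs, meander n S E c bs /\ eqv (meander_word n c bs) w.
Proof.
rewrite /planar_seq size_wh_exp; set m := size w.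
rewrite -muln2 mulnK // muln2 => -[s [s_perm]].
set pi := nth 0 s => s_mon s_top s_bot.
have sz : size s = m.+1.*2 by rewrite (perm_size s_perm) size_iota.
have us : uniq s by rewrite (perm_uniq s_perm) iota_uniq.
set C := wh_exp w in s_mon *.
(* [index] inverts the permutation, recovering the entry placed at x. *)
pose c x := (nth 0 C (index x s))./2.
have cE k : k < m.+1.*2 -> c (pi k) = (nth 0 C k)./2.
  by move=> kN; rewrite /c index_uniq ?sz.
pose bs := [seq (pi i.*2.+1, pi i.*2.+2) | i <- iota 0 m].
have ptsE x : x \in pts bs -> exists2 k, 0 < k < m.*2.+1 & x = pi k.
  case/flattenP=> t /mapP[e /mapP[i]]; rewrite mem_iota => /andP[_ im] -> ->.
  by rewrite !inE => /orP[]/eqP->; [exists i.*2.+1|exists i.*2.+2]; rewrite //=; lia.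
have lt_pi j k : j < m.+1.*2 -> k < m.+1.*2 -> nth 0 C j < nth 0 C k -> pi j < pi k.
  move=> jN kN jk; rewrite ltnNge leq_eqVlt; apply/norP; split.
    by rewrite nth_uniq ?sz //; apply: contraTneq jk => ->; rewrite ltnn.
  by apply: contraTN jk => /s_mon-/(_ kN jN); rewrite leqNgt.
have inner k : 0 < k < m.*2.+1 -> 0 < nth 0 C k < n.*2.+1.
  by case/andP; apply: wh_exp_inner.
have C0 : nth 0 C 0 = 0 by [].
have CN : nth 0 C m.*2.+1 = n.*2.+1 by apply: nth_wh_exp_last.
exists (pi 0), (pi m.*2.+1), c, bs; split; first split.
(* The extreme symbols occur only at the two ends of the expansion, so these ends are placed
   outermost. *)
- move=> x /ptsE[k km ->]; have := inner _ km => Ck.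
  by apply/andP; split; apply: lt_pi; rewrite ?C0 ?CN; lia.
- rewrite pairwise_map; apply: uniq_pairwise (iota_uniq _ _) _ => i j.
  by rewrite !mem_iota => im jm; apply: s_bot; rewrite ?ltnS; lia.
- have -> : tops (pi 0) bs (pi m.*2.+1) = _ := tops_iota pi 0 m.
  rewrite pairwise_map.
  apply: uniq_pairwise (iota_uniq _ _) _ => i j.
  by rewrite !mem_iota => im jm; apply: s_top; lia.
- move=> x y /ptsE[k km ->] /ptsE[l lm ->] kl.
  by rewrite !cE; try lia; apply: half_leq; apply: s_mon kl; lia.
- move=> x /ptsE[k km ->]; rewrite cE; last by lia.
  by have := inner _ km; lia.
rewrite /meander_word /bs -map_comp.
have -> : flatten [seq (fun e => winv (tprod n (c e.1)) ++ tprod n (c e.2))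
    (pi i.*2.+1, pi i.*2.+2) | i <- iota 0 m] =
  flatten [seq winv (tprod n (code a)./2) ++ tprod n (code (linv a))./2 | a <- w].
  congr flatten; pose F (x y : nat) : word n := winv (tprod n x./2) ++ tprod n y./2.
  transitivity [seq F (nth 0 [seq code a | a <- w] i)
                      (nth 0 [seq code (linv a) | a <- w] i) | i <- iota 0 m].
    apply/eq_in_map => i; rewrite mem_iota => im /=.
    by rewrite !cE; try lia; case: (nth_wh_exp (w := w) (i := i)) => [|-> ->] //; lia.
  rewrite /m; elim: (w) => //= a w' IH; congr (_ :: _).
  by rewrite (iotaDl 1 0) -map_comp.
elim: (w) => //= a w' IH; rewrite eqv_letter IH; reflexivity.
Qed.

(** The expansion is 0, 1, ..., 2k, 2n+1, already increasing, so the identity permutation works. *)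
Lemma planar_tprod k : k <= n -> planar (tprod n k).
Proof.
move=> kn; rewrite /planar reduce_id ?reduced_tprod // /planar_seq size_wh_exp.
have szk : size (tprod n k) = k by rewrite size_map size_takel // size_enum_ord.
rewrite szk -muln2 mulnK // muln2; exists (iota 0 k.+1.*2).
have nthE i : i < k.+1.*2 -> nth 0 (iota 0 k.+1.*2) i = i by move=> ?; rewrite nth_iota.
have wE i : i < k.+1.*2 ->
    nth 0 (wh_exp (tprod n k)) i = if i == k.*2.+1 then n.*2.+1 else i.
  have codeE j (jk : j < k) : nth 0 [seq code a | a <- tprod n k] j = j.*2.+1 /\
      nth 0 [seq code (linv a) | a <- tprod n k] j = j.*2.+2.
    have jn := leq_trans jk kn; have szt : size (take k (enum 'I_n)) = k.
      by rewrite size_takel // size_enum_ord.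
    rewrite /tprod -!map_comp !(nth_map (Ordinal jn)) ?szt // nth_take //.
    by rewrite /code /= nth_enum_ord.
  case: i => // i iN; rewrite eqSS; case: eqP => [->|ne].
    by have := nth_wh_exp_last (tprod n k); rewrite szk.
  have ik : i./2 < size (tprod n k) by rewrite szk; lia.
  have [w1 w2] := nth_wh_exp ik.
  rewrite szk in ik; have [c1 c2] := codeE _ ik.
  rewrite -[i]odd_double_half; case: (odd i); first by rewrite add1n w2 c2.
  by rewrite add0n w1 c1.
split=> [//|i j iN jN|i j iM jM ij|i j iM jM ij].
- by rewrite !nthE // !wE // => lt_ij; do 2![case: eqP => ?]; lia.
- by rewrite !nthE; try lia; rewrite -[nested _ _ _ _]/(nest (_, _) (_, _)) nestE; lia.
- by rewrite !nthE; try lia; rewrite -[nested _ _ _ _]/(nest (_, _) (_, _)) nestE; lia.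
Qed.
End WhiteheadExpansion.

Theorem theoremA (n : nat) :
  (forall k, k <= n -> planar (tprod n k)) /\
  (forall w : word n, reduced w -> planar w ->
     exists! k, k <= n /\ in_Bn_orbit w (tprod n k)).
Proof.
split=> [|w rw]; first exact: planar_tprod.
rewrite /planar reduce_id // => /planar_meander[S [E [c [bs [mb wE]]]]].
have [k kn ok] := meander_orb mb; rewrite wE in ok.
exists k; split; first by split=> //; apply/orb_in_Bn_orbit.
move=> k' [kn' /orb_in_Bn_orbit/orb_expsum]; rewrite (orb_expsum ok).
by rewrite !expsum_tprod //; lia.
Qed.
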